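(* Let $\mathbb{U}$ be a universe set. If $\mathcal{S}$ is an SVN-filter subbase on $\mathcal{SVN}(\mathbb{U})$, then $\langle \mathcal{S}^* \rangle$ is the coarsest SVN-filter on $\mathcal{SVN}(\mathbb{U})$ containing $\mathcal{S}$; that is, $\langle \mathcal{S}^* \rangle$ is an SVN-filter on $\mathcal{SVN}(\mathbb{U})$ such that: (i) $\mathcal{S} \subseteq \langle \mathcal{S}^* \rangle$; and (ii) for every SVN-filter $\mathcal{H}$ on $\mathcal{SVN}(\mathbb{U})$ such that $\mathcal{S} \subseteq \mathcal{H}$, it follows that $\langle \mathcal{S}^* \rangle \subseteq \mathcal{H}$.
   Context: A single valued neutrosophic set (SVN-set) over a set $\mathbb{U}$ is a triple $\widetilde{A} = \langle \mu_A, \sigma_A, \omega_A \rangle$ of arbitrary functions $\mathbb{U} \to [0,1]$ (membership, indeterminacy, nonmembership). $\mathcal{SVN}(\mathbb{U})$ is the set of all SVN-sets over $\mathbb{U}$. Inclusion: $\widetilde{A} \sqsubseteq \widetilde{B}$ means $\mu_A(u) \le \mu_B(u)$, $\sigma_A(u) \le \sigma_B(u)$ and $\omega_A(u) \ge \omega_B(u)$ for every $u \in \mathbb{U}$. Two SVN-sets are equal if each is included in the other. Intersection: $\widetilde{A} \sqcap \widetilde{B} = \langle \min(\mu_A,\mu_B), \min(\sigma_A,\sigma_B), \max(\omega_A,\omega_B)\rangle$ (pointwise). The neutrosophic empty set is $\widetilde{\emptyset} = \langle 0,0,1\rangle$ (constant functions). A nonempty family $\mathcal{S} \subseteq \mathcal{SVN}(\mathbb{U})$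 is an SVN-filter subbase on $\mathcal{SVN}(\mathbb{U})$ if for every integer $n \ge 1$ and all $\widetilde{A}_1,\ldots,\widetilde{A}_n \in \mathcal{S}$, $\widetilde{A}_1 \sqcap \cdots \sqcap \widetilde{A}_n \ne \widetilde{\emptyset}$. For such $\mathcal{S}$, $\mathcal{S}^* = \{ \widetilde{A}_1 \sqcap \cdots \sqcap \widetilde{A}_n : n \ge 1,\ \widetilde{A}_1,\ldots,\widetilde{A}_n \in \mathcal{S} \}$ denotes the set of all finite intersections of members of $\mathcal{S}$ (it is an SVN-filter base). A nonempty family $\mathcal{F} \subseteq \mathcal{SVN}(\mathbb{U})$ is an SVN-filter base on $\mathcal{SVN}(\mathbb{U})$ if $\widetilde{\emptyset} \notin \mathcal{F}$ and for every $\widetilde{F}, \widetilde{G} \in \mathcal{F}$ there exists $\widetilde{H} \in \mathcal{F}$ with $\widetilde{H} \sqsubseteq \widetilde{F} \sqcap \widetilde{G}$. It is an SVN-filter if it is an SVN-filter base and for every $\widetilde{F} \in \mathcal{F}$ and every $\widetilde{A} \in \mathcal{SVN}(\mathbb{U})$ with $\widetilde{F} \sqsubseteq \widetilde{A}$ one has $\widetilde{A} \in \mathcal{F}$. For an SVN-filter base $\mathcal{F}$, its neutrosophic filter completion is $\langle \mathcal{F} \rangle = \{ \widetilde{A} \in \mathcal{SVN}(\mathbb{U}) : \exists\, \widetilde{F} \in \mathcal{F},\ \widetilde{F} \sqsubseteq \widetilde{A} \}$. $\mathcal{F}$ is coarser than $\mathcal{G}$ if $\mathcal{F} \subseteq \mathcal{G}$.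 *)

(* Defs.v *)
From HB Require Import structures.
From mathcomp Require Import all_boot all_order all_algebra.
From mathcomp Require Import boolp classical_sets reals interval_inference.

Set Implicit Arguments.
Unset Strict Implicit.
Unset Printing Implicit Defensive.

Import Order.TTheory GRing.Theory Num.Theory.

Local Open Scope classical_set_scope.
Local Open Scope ring_scope.

(* [{i01 R}] is the closed unit interval of [R], ordered as a subset of [R]. *)
Record svn_set (R : realType) (U : Type) := SVNSet {
  membership : U -> {i01 R} ;
  indeterminacy : U -> {i01 R} ;
  nonmembership : U -> {i01 R} }.

Section SVNSets.
Context {R : realType} {U : Type}.
Implicit Types A B C : svn_set R U.

Definition svn_sub A B : Prop := forall u : U,
  [/\ membership A u <= membership B u,
      indeterminacy A u <= indeterminacy B u &
      nonmembership B u <= nonmembership A u].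

Definition svn_inter A B : svn_set R U :=
  SVNSet (fun u => Order.min (membership A u) (membership B u))
         (fun u => Order.min (indeterminacy A u) (indeterminacy B u))
         (fun u => Order.max (nonmembership A u) (nonmembership B u)).

Definition svn_empty : svn_set R U :=
  SVNSet (fun=> 0%:i01) (fun=> 0%:i01) (fun=> 1%:i01).

Definition svn_full : svn_set R U :=
  SVNSet (fun=> 1%:i01) (fun=> 1%:i01) (fun=> 0%:i01).

(* Leibniz equality of SVN-sets is mutual inclusion. *)
Lemma svn_eqP A B : A = B <-> svn_sub A B /\ svn_sub B A.
Proof.
split=> [->|[AB BA]]; first by split=> u; split.
case: A B AB BA => [mA sA wA] [mB sB wB] AB BA.
congr SVNSet; apply/funext => u;
  have [/= h1 h2 h3] := AB u; have [/= k1 k2 k3] := BA u;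
  by apply/le_anti/andP; split.
Qed.

Lemma svn_interA : associative svn_inter.
Proof.
move=> A B C; congr SVNSet; apply/funext => u /=;
  by rewrite ?minA ?maxA.
Qed.

Lemma svn_interC : commutative svn_inter.
Proof.
move=> A B; congr SVNSet; apply/funext => u /=;
  by rewrite 1?minC 1?maxC.
Qed.

Lemma svn_inter_fulll : left_id svn_full svn_inter.
Proof.
case=> m s w; congr SVNSet; apply/funext => u /=.
- by apply/min_idPr; rewrite -num_le /= le1.
- by apply/min_idPr; rewrite -num_le /= le1.
- by apply/max_idPr; rewrite -num_le /=.
Qed.

End SVNSets.

HB.instance Definition _ (R : realType) (U : Type) :=
  Monoid.isComLaw.Build (svn_set R U) svn_full svn_inter
    svn_interA svn_interC svn_inter_fulll.

Section SVNFilters.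
Context {R : realType} {U : Type}.
Implicit Types (A F G H : svn_set R U) (FF SS : set (svn_set R U)).

(* [svn_full] is neutral for [svn_inter], so that for [0 < n] this is
   [A_1] meet ... meet [A_n]. *)
Definition svn_bigcap (n : nat) (A : 'I_n -> svn_set R U) : svn_set R U :=
  \big[svn_inter/svn_full]_(i < n) A i.

Definition svn_filter_subbase SS : Prop :=
  SS !=set0 /\
  forall (n : nat) (A : 'I_n -> svn_set R U), (0 < n)%N ->
    (forall i, SS (A i)) -> svn_bigcap A <> svn_empty.

Definition svn_finite_inters SS : set (svn_set R U) :=
  [set B | exists (n : nat) (A : 'I_n -> svn_set R U),
    [/\ (0 < n)%N, forall i, SS (A i) & B = svn_bigcap A]].

Definition svn_filter_base FF : Prop :=
  [/\ FF !=set0, ~ FF svn_empty &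
      forall F G, FF F -> FF G ->
        exists2 H, FF H & svn_sub H (svn_inter F G)].

Definition svn_filter FF : Prop :=
  svn_filter_base FF /\ forall F A, FF F -> svn_sub F A -> FF A.

Definition svn_completion FF : set (svn_set R U) :=
  [set A | exists2 F, FF F & svn_sub F A].

End SVNFilters.

(* Main.v *)
Require Import Defs.
From mathcomp Require Import all_boot all_order all_algebra.
From mathcomp Require Import boolp classical_sets reals interval_inference.

Local Open Scope classical_set_scope.

Import Order.TTheory Num.Theory.

(** Finite meets of members of [S] are closed under binary meet, and the subbase condition keeps
    [svn_empty] out of them, so they form a filter base ([svn_filter_base_finite_inters]). The
    upward closure of a filter base is a filter ([svn_filter_completion]), because meet is monotone
    and only [svn_empty] lies below [svn_empty]. For minimality, a filter is closed under finite
    meets ([svn_filter_bigcap]), so one that contains [S] contains all these meets and, being upward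
    closed, everything above them. *)

Section SVNInclusion.
Context {R : realType} {U : Type}.
Implicit Types A B C : svn_set R U.

Lemma svn_sub_refl A : svn_sub A A.
Proof. by move=> u; split. Qed.

Lemma svn_sub_trans B A C : svn_sub A B -> svn_sub B C -> svn_sub A C.
Proof.
move=> AB BC u; have [h1 h2 h3] := AB u; have [k1 k2 k3] := BC u.
by split; [exact: le_trans k1|exact: le_trans k2|exact: le_trans h3].
Qed.

Lemma svn_sub0 A : svn_sub A svn_empty -> A = svn_empty.
Proof.
move=> A0; apply/svn_eqP; split=> // u.
by split; rewrite -num_le /= ?le1.
Qed.

Lemma svn_sub_full A : svn_sub A svn_full.
Proof. by move=> u; split; rewrite -num_le /= ?le1. Qed.

Lemma svn_interS A A' B B' :
  svn_sub A A' -> svn_sub B B' -> svn_sub (svn_inter A B) (svn_inter A' B').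
Proof.
move=> AA BB u; have [h1 h2 h3] := AA u; have [k1 k2 k3] := BB u.
by split=> /=; [exact: le_min2|exact: le_min2|exact: le_max2].
Qed.

End SVNInclusion.

Section SVNFilterTheory.
Context {R : realType} {U : Type}.
Implicit Types (A B : svn_set R U) (F S : set (svn_set R U)).

Lemma svn_finite_inters_sub S : S `<=` svn_finite_inters S.
Proof.
move=> A SA; exists 1, (fun=> A); split=> //.
by rewrite /svn_bigcap big_ord1.
Qed.

(** Concatenating the two families of members of [S] gives one family whose meet is the meet of the
    two. *)
Lemma svn_finite_inters_inter S A B :
  svn_finite_inters S A -> svn_finite_inters S B ->
  svn_finite_inters S (svn_inter A B).
Proof.
move=> [m [f [m0 Sf ->]]] [n [g [n0 Sg ->]]].
(* [split] sends an index below [m + n] to the left or right family. *)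
exists (m + n), (fun i => match split i with inl j => f j | inr k => g k end).
split; first by rewrite addn_gt0 m0.
  by move=> i; case: (split i).
rewrite /svn_bigcap big_split_ord /=; congr svn_inter; apply: eq_bigr => i _.
  by rewrite (unsplitK (inl i)).
by rewrite (unsplitK (inr i)).
Qed.

Lemma svn_filter_base_finite_inters S :
  svn_filter_subbase S -> svn_filter_base (svn_finite_inters S).
Proof.
move=> [[A SA] S0]; split.
- by exists A; exact: svn_finite_inters_sub.
- by move=> [n [f [n0 Sf /esym]]]; exact: S0.
- move=> F G SF SG; exists (svn_inter F G); last exact: svn_sub_refl.
  exact: svn_finite_inters_inter.
Qed.

Lemma svn_completion_sub F : F `<=` svn_completion F.
Proof. by move=> A FA; exists A => //; exact: svn_sub_refl. Qed.

Lemma svn_filter_completion F :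
  svn_filter_base F -> svn_filter (svn_completion F).
Proof.
move=> [[A FA] F0 FI]; split; last first.
  by move=> B C [G FG GB] BC; exists G => //; exact: svn_sub_trans BC.
split; first by exists A; exact: svn_completion_sub.
- by move=> [G FG /svn_sub0 G0]; apply: F0; rewrite -G0.
- move=> B C [G FG GB] [G' FG' GC]; have [K FK KI] := FI _ _ FG FG'.
  exists K; first exact: svn_completion_sub.
  exact: svn_sub_trans KI (svn_interS _ _ _ _ GB GC).
Qed.

(** Covers the empty meet, from which [svn_bigcap] starts. *)
Lemma svn_filter_full F : svn_filter F -> F svn_full.
Proof. by move=> [[[A FA] _ _] up]; apply: up FA _; exact: svn_sub_full. Qed.

(** The base condition gives a member below the meet; upward closure lifts it to the meet itself. *)
Lemma svn_filter_inter F A B :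
  svn_filter F -> F A -> F B -> F (svn_inter A B).
Proof.
by move=> [[_ _ FI] up] FA FB; have [K FK] := FI _ _ FA FB; exact: up.
Qed.

Lemma svn_filter_bigcap F n (A : 'I_n -> svn_set R U) :
  svn_filter F -> (forall i, F (A i)) -> F (svn_bigcap A).
Proof.
move=> FF FA; apply: big_ind => //; first exact: svn_filter_full.
by move=> B C; exact: svn_filter_inter.
Qed.

End SVNFilterTheory.

Theorem proposition3p17 (R : realType) (U : Type) (S : set (svn_set R U)) :
  svn_filter_subbase S ->
  [/\ svn_filter (svn_completion (svn_finite_inters S)),
      S `<=` svn_completion (svn_finite_inters S) &
      forall H : set (svn_set R U), svn_filter H -> S `<=` H ->
        svn_completion (svn_finite_inters S) `<=` H].
Proof.
move=> subS; split.
- exact/svn_filter_completion/svn_filter_base_finite_inters.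
- by move=> A /svn_finite_inters_sub; exact: svn_completion_sub.
(* The inclusion of the meet of [f] in [A] stays in the goal, so upward closure of [H] leaves only
   that this meet lies in [H]. *)
- move=> H filH SH A [_ [n [f [_ Sf ->]]]]; apply: filH.2.
  by apply: svn_filter_bigcap => // i; exact: SH.
Qed.
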